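(* Let $G=(V,A,E)$ be a mixed graph in which every pseudo dicut contains at least $2$ edges from $E$. Let $d$ be the number of connected components of the $2$-pseudo-dicut graph of $G$, and let $\kappa$ be the minimum number of elements of $E$ in a rainbow pseudo dicut ($\kappa=+\infty$ if there is none, with $H(1/\kappa)$ then read as $0$). Then the number of $G$-strong orientations is at least $2^{(1-H(1/\kappa))d}$.
   Context: A mixed graph $G=(V,A,E)$ has arcs $A$ (directed) and edges $E$ (undirected). A $G$-strong orientation is an orientation of $E$ which together with $A$ yields a strongly connected digraph. A pseudo dicut is a cut $\delta_G(U)\subseteq A\cup E$ with $\emptyset\neq U\subsetneq V$ and no arc of $A$ entering $U$. The $2$-pseudo-dicut graph of $G$ is the graph on vertex set $E$ with an edge between distinct $e,f\in E$ for every pseudo dicut whose set of elements from $E$ is exactly $\{e,f\}$. A pseudo dicut is rainbow if it contains at most one element of $E$ from each connected component of the $2$-pseudo-dicut graph. $H$ is the binary entropy function $H(\varepsilon)=-\varepsilon\log_2\varepsilon-(1-\varepsilon)\log_2(1-\varepsilon)$ for $\varepsilon\in(0,\tfrac12]$, $H(0)=0$. *)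

(* Defs.v *)
From HB Require Import structures.
From mathcomp Require Import all_boot all_order all_algebra.
From mathcomp Require Import reals constructive_ereal exp.

Set Implicit Arguments.
Unset Strict Implicit.
Unset Printing Implicit Defensive.

Import Order.TTheory GRing.Theory Num.Theory.
Local Open Scope ring_scope.

(* Finite mixed graphs; parallel arcs and edges and loops are allowed. The order
   of the two components of [ends e] carries no meaning: it only serves as a
   reference direction in which to express orientations. *)
Record mixedGraph := MixedGraph {
  vertices : finType;
  arcs : finType;
  edges : finType;
  arc_tail : arcs -> vertices;
  arc_head : arcs -> vertices;
  ends : edges -> vertices * vertices }.

Section MixedGraph.
Variable G : mixedGraph.

(* [o e] says whether [e] is directed from [(ends e).1] to [(ends e).2] or the
   other way round; thus a loop has two orientations. *)
Definition orientation : finType := {ffun edges G -> bool}.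

Definition edge_tail (o : orientation) (e : edges G) : vertices G :=
  if o e then (ends e).1 else (ends e).2.

Definition edge_head (o : orientation) (e : edges G) : vertices G :=
  if o e then (ends e).2 else (ends e).1.

Definition oriented_adj (o : orientation) : rel (vertices G) := fun u v =>
  [exists a : arcs G, (arc_tail a == u) && (arc_head a == v)]
  || [exists e : edges G, (edge_tail o e == u) && (edge_head o e == v)].

Definition strong (o : orientation) : bool :=
  [forall u : vertices G, forall v : vertices G, connect (oriented_adj o) u v].

Definition strong_orientations : {set orientation} :=
  [set o : orientation | strong o].

Definition cut (U : {set vertices G}) : {set arcs G + edges G} :=
  [set x : arcs G + edges G |
    match x with
    | inl a => (arc_tail a \in U) != (arc_head a \in U)
    | inr e => ((ends e).1 \in U) != ((ends e).2 \in U)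
    end].

Definition arc_enters (U : {set vertices G}) (a : arcs G) : bool :=
  (arc_tail a \notin U) && (arc_head a \in U).

Definition pseudo_dicut (D : {set arcs G + edges G}) : bool :=
  [exists U : {set vertices G},
    [&& U != set0, U \proper [set: vertices G],
        [forall a : arcs G, ~~ arc_enters U a] & D == cut U]].

Definition cut_edges (D : {set arcs G + edges G}) : {set edges G} :=
  [set e : edges G | inr e \in D].

Definition pseudo_dicut_graph2 : rel (edges G) := fun e f =>
  (e != f) && [exists D, pseudo_dicut D && (cut_edges D == [set e; f])].

Definition num_components2 : nat := n_comp pseudo_dicut_graph2 {: edges G}.

Definition rainbow (D : {set arcs G + edges G}) : bool :=
  [forall e in cut_edges D, forall f in cut_edges D,
    connect pseudo_dicut_graph2 e f ==> (e == f)].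

(* The minimum over the empty family is [+oo]. *)
Definition rainbow_min (R : realType) : \bar R :=
  \big[Order.min/+oo%E]_(D : {set arcs G + edges G} | pseudo_dicut D && rainbow D)
    (#|cut_edges D|%:R)%:E.

End MixedGraph.

Section Entropy.
Variable R : realType.

Definition log2 (x : R) : R := ln x / ln 2.

Definition entropy (x : R) : R :=
  if x == 0 then 0 else - x * log2 x - (1 - x) * log2 (1 - x).

(* [H(1/k)] for an extended real [k], with [H(1/oo) = 0]. *)
Definition entropy_inv (k : \bar R) : R :=
  if k is r%:E%E then entropy (1 / r) else 0.

End Entropy.

(* Main.v *)
Require Import Defs.
From HB Require Import structures.
From mathcomp Require Import all_boot all_order all_algebra.
From mathcomp Require Import reals constructive_ereal sequences exp.
From mathcomp Require Import ring lra zify.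

(** Call [U] a shore if it is the side of a pseudo dicut that no arc enters: an
    orientation is strong iff an edge enters every shore.  Shores are closed
    under intersection and union of crossing pairs, and by uncrossing the
    polytope of all [y] in [[0, 1]^E] with [inflow y U >= 1] on every shore [U]
    is integral: any point can be rounded to a strong orientation without
    increasing a given linear cost and keeping tight shores tight.

    Rounding the constant point [1/2] yields an orientation in which every
    pseudo dicut with two edges has one edge in each direction.  Flipping whole
    components of the 2-pseudo-dicut graph preserves this property, which gives
    [2^d] orientations.  Blurring such an orientation by [1/kappa] gives a point
    of the polytope: in a smallest violated shore all edges leave, two of them
    in a common component unless the shore is rainbow, and uncrossing it with
    the two-edge shores is contradictory.  Rounding that point with the number
    of flipped components as cost yields a strong orientation that differs in at
    most [d / kappa] components.  So the strong orientations form a covering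
    code of radius [d / kappa] in [{0, 1}^d], and the entropy bound on the
    volume of Hamming balls concludes. *)

Set Implicit Arguments.
Unset Strict Implicit.
Unset Printing Implicit Defensive.

Import Order.TTheory GRing.Theory Num.Theory.
Local Open Scope ring_scope.

(** * Atoms of a crossing family *)

Section Atoms.
Variables (V : finType) (T : pred {set V}).

Definition crossing_closed : Prop := forall U W : {set V}, T U -> T W ->
  U :&: W != set0 -> U :|: W != setT -> T (U :&: W) /\ T (U :|: W).

Definition atom (v : V) : {set V} :=
  [set w | [forall U, T U ==> ((w \in U) == (v \in U))]].

Definition saturated (X : {set V}) : Prop :=
  forall v w, v \in atom w -> (v \in X) = (w \in X).

Lemma atomP v w : reflect (forall U, T U -> (w \in U) = (v \in U)) (w \in atom v).
Proof.
rewrite inE; apply: (iffP forallP) => [h U TU | h U].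
  by move/implyP: (h U) => /(_ TU) /eqP.
by apply/implyP => /h ->.
Qed.

Lemma atom_refl v : v \in atom v.
Proof. exact/atomP. Qed.

Lemma eq_atom v w : w \in atom v -> atom w = atom v.
Proof.
move=> /atomP h; apply/setP => u.
by apply/atomP/atomP => hu U TU; rewrite hu // h.
Qed.

Lemma saturated_mem U : T U -> saturated U.
Proof. by move=> TU v w /atomP ->. Qed.

Lemma saturatedC X : saturated X -> saturated (~: X).
Proof. by move=> h v w /h; rewrite !inE => ->. Qed.

Lemma saturatedI X Y : saturated X -> saturated Y -> saturated (X :&: Y).
Proof. by move=> hX hY v w vw; rewrite !inE (hX _ _ vw) (hY _ _ vw). Qed.

Definition splitter v (X : {set V}) : bool :=
  (X == set0) || (v \notin X) && (T X || T (~: X)).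

Lemma splitter_sub_atomC v X : splitter v X -> X \subset ~: atom v.
Proof.
case/orP => [/eqP->|/andP[vX TX]]; first exact: sub0set.
apply/subsetP => w wX; rewrite inE; apply/negP => /atomP h.
case/orP: TX => TX; first by move: vX; rewrite -(h _ TX) wX.
by move: (h _ TX); rewrite !inE wX vX.
Qed.

(** Two members of [T], or two complements of members, merge into their union, since they intersect
    and [v] lies outside both. A member [X] and a complement [Y] become [X :\: Y] and [Y], unless
    they are nested. *)
Lemma splitter_uncross v X Y : crossing_closed ->
    splitter v X -> splitter v Y -> ~~ [disjoint X & Y] ->
  exists A B, [/\ splitter v A, splitter v B, [disjoint A & B] & A :|: B = X :|: Y].
Proof.
move=> ccT sX sY; rewrite -setI_eq0 => XY.
have spl0 : splitter v set0 by rewrite /splitter eqxx.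
have nX : X != set0 by apply: contraNneq XY => ->; rewrite set0I.
have nY : Y != set0 by apply: contraNneq XY => ->; rewrite setI0.
have /andP[vX TX] : (v \notin X) && (T X || T (~: X)).
  by move: sX; rewrite /splitter (negPf nX).
have /andP[vY TY] : (v \notin Y) && (T Y || T (~: Y)).
  by move: sY; rewrite /splitter (negPf nY).
have vXY : v \notin X :|: Y by rewrite inE negb_or vX.
have mixed (X1 Y1 : {set V}) : v \notin X1 -> v \notin Y1 -> T X1 -> T (~: Y1) ->
    splitter v X1 -> splitter v Y1 ->
    exists A B, [/\ splitter v A, splitter v B, [disjoint A & B] & A :|: B = X1 :|: Y1].
  move=> vX1 vY1 TX1 TY1 sX1 sY1.
  have [e0|e0] := eqVneq (X1 :\: Y1) set0.
    exists set0, Y1; split=> //; first by rewrite -setI_eq0 set0I.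
    by rewrite set0U; apply/esym/setUidPr; rewrite -setD_eq0 e0.
  have [eT|eT] := eqVneq (X1 :|: ~: Y1) setT.
    exists X1, set0; split=> //; first by rewrite -setI_eq0 setI0.
    rewrite setU0; apply/esym/setUidPl/subsetP => y yY.
    by move/setP/(_ y): eT; rewrite !inE yY orbF.
  have [|T1 _] := ccT _ _ TX1 TY1 _ eT; first by rewrite -setDE.
  exists (X1 :\: Y1), Y1; split=> //.
  - by rewrite /splitter setDE T1 !inE (negPf vX1) orbT.
  - by rewrite -setI_eq0; apply/eqP/setP => y; rewrite !inE; case: (y \in Y1); rewrite ?andbF.
  - by apply/setP => y; rewrite !inE; case: (y \in Y1); rewrite ?orbT.
case/orP: TX => TX; case/orP: TY => TY.
- have [||_ T1] := ccT _ _ TX TY => //.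
    by apply: contraNneq vXY => ->; rewrite inE.
  exists (X :|: Y), set0; split=> //; last by rewrite setU0.
    by rewrite /splitter vXY T1 orbT.
  by rewrite -setI_eq0 setI0.
- exact: mixed.
- have [A [B [h1 h2 h3 h4]]] := mixed Y X vY vX TY TX sY sX.
  by exists A, B; split=> //; rewrite h4 setUC.
- have [||T1 _] := ccT _ _ TX TY.
  + by apply/set0Pn; exists v; rewrite !inE vX.
  + rewrite -setCI; apply: contraNneq XY => e.
    by rewrite -[X :&: Y]setCK e setCT.
  exists (X :|: Y), set0; split=> //; last by rewrite setU0.
    by rewrite /splitter vXY setCU T1 !orbT.
  by rewrite -setI_eq0 setI0.
Qed.

(* A cover of [~: atom v] of minimum total size is disjoint, since two
   intersecting members can be uncrossed. *)
Lemma atom_partition v : crossing_closed ->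
  exists Q : {set {set V}}, [/\ trivIset Q, cover Q = ~: atom v
    & {in Q, forall X, splitter v X}].
Proof.
move=> ccT.
pose good (Q : {set {set V}}) :=
  [forall X in Q, splitter v X] && (~: atom v \subset cover Q).
pose wt (Q : {set {set V}}) := (\sum_(X in Q) #|X|)%N.
have good0 : good [set X | splitter v X].
  apply/andP; split; first by apply/forall_inP => X; rewrite inE.
  apply/subsetP => w; rewrite !inE => /forallPn[U]; rewrite negb_imply => /andP[TU ne].
  apply/bigcupP; have [vU|vU] := boolP (v \in U).
    exists (~: U); last by move: ne; rewrite !inE vU; case: (w \in U).
    by rewrite inE /splitter setCK TU !inE vU !orbT.
  exists U; last by move: ne; rewrite (negPf vU); case: (w \in U).
  by rewrite inE /splitter TU vU !orbT.
case: (arg_minnP wt good0) => Q /andP[/forall_inP sQ cQ] Qmin.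
exists Q; split=> //; last first.
  apply/eqP; rewrite eqEsubset cQ andbT; apply/bigcupsP => X /sQ.
  exact: splitter_sub_atomC.
apply/trivIsetP => X Y XQ YQ nXY; apply/negPn/negP => dXY.
have [A [B [sA sB dAB eAB]]] := splitter_uncross ccT (sQ _ XQ) (sQ _ YQ) dXY.
pose Q' := A |: (B |: Q :\ X :\ Y).
have /Qmin : good Q'.
  apply/andP; split.
    apply/forall_inP => Z; rewrite !inE.
    by case/or3P => [/eqP->|/eqP->|/and3P[_ _ /sQ]].
  apply: subset_trans cQ _; apply/bigcupsP => Z ZQ; apply/subsetP => z zZ.
  apply/bigcupP; have [ZXY|] := boolP ((Z == X) || (Z == Y)).
    have : z \in A :|: B.
      by rewrite eAB inE; case/orP: ZXY zZ => /eqP-> ->; rewrite ?orbT.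
    by rewrite inE => /orP[]; [exists A | exists B]; rewrite ?inE ?eqxx ?orbT.
  rewrite negb_or => /andP[ZX ZY]; exists Z => //.
  by rewrite !inE ZX ZY ZQ !orbT.
have sumU1 (Z : {set V}) (S : {set {set V}}) : (wt (Z |: S) <= #|Z| + wt S)%N.
  have [ZS|ZS] := boolP (Z \in S); last by rewrite /wt big_setU1.
  by rewrite (setUidPr _) ?leq_addl // sub1set.
have cAB : (#|A| + #|B| < #|X| + #|Y|)%N.
  move: dAB dXY; rewrite -!setI_eq0 => /eqP dAB.
  have := cardsUI A B; have := cardsUI X Y; rewrite dAB eAB cards0 -card_gt0; lia.
have -> : wt Q = (#|X| + (#|Y| + wt (Q :\ X :\ Y)))%N.
  rewrite /wt (big_setD1 X XQ) (big_setD1 Y) //=.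
  by rewrite !inE eq_sym nXY.
have := sumU1 A (B |: Q :\ X :\ Y); have := sumU1 B (Q :\ X :\ Y).
rewrite -/Q'; lia.
Qed.

End Atoms.

(** * Net flow into unions of atoms *)

Section Boundary.
Variables (V E : finType) (tl hd : E -> V) (R : pzRingType).

Definition boundary (y : E -> R) (X : {set V}) : R :=
  \sum_e y e * ((hd e \in X)%:R - (tl e \in X)%:R).

Lemma boundary_sum y X : boundary y X = \sum_(v in X) boundary y [set v].
Proof.
rewrite /boundary exchange_big /=; apply: eq_bigr => e _.
rewrite -mulr_sumr sumrB; congr (_ * (_ - _)).
  rewrite (eq_bigr (fun v => (v == hd e)%:R)); last by move=> v _; rewrite inE eq_sym.
  rewrite big_mkcond (bigD1 (hd e)) //= eqxx big1 ?addr0; first by case: (_ \in _).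
  by move=> v /negPf ->; case: (_ \in _).
rewrite (eq_bigr (fun v => (v == tl e)%:R)); last by move=> v _; rewrite inE eq_sym.
rewrite big_mkcond (bigD1 (tl e)) //= eqxx big1 ?addr0; first by case: (_ \in _).
by move=> v /negPf ->; case: (_ \in _).
Qed.

Lemma boundaryC y X : boundary y (~: X) = - boundary y X.
Proof.
rewrite /boundary -sumrN; apply: eq_bigr => e _; rewrite !inE -mulrN; congr (_ * _).
by case: (hd e \in X); case: (tl e \in X); rewrite /= ?subrr ?subr0 ?sub0r ?oppr0 ?opprK.
Qed.

Lemma boundary0 y : boundary y set0 = 0.
Proof. by rewrite /boundary big1 // => e _; rewrite !inE subrr mulr0. Qed.

Lemma boundaryUI y X Y :
  boundary y (X :|: Y) + boundary y (X :&: Y) = boundary y X + boundary y Y.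
Proof.
have h W : boundary y W = \sum_v if v \in W then boundary y [set v] else 0.
  by rewrite boundary_sum big_mkcond.
rewrite (h (X :|: Y)) (h (X :&: Y)) (h X) (h Y) -!big_split /=; apply: eq_bigr => v _; rewrite !inE.
by case: (v \in X); case: (v \in Y); rewrite ?addr0 ?add0r.
Qed.

Lemma boundaryD y X Y :
  boundary y X = boundary y (X :&: Y) + boundary y (X :\: Y).
Proof.
rewrite (boundary_sum y X) (boundary_sum y (X :&: Y)) (boundary_sum y (X :\: Y)).
exact: big_setID.
Qed.

Variable T : pred {set V}.
Hypothesis ccT : crossing_closed T.

(** [S] is an additive subgroup, later zero or the integers. The complement of an atom is a disjoint
    union of splitters, each with boundary zero or plus or minus that of a member of [T]. *)
Lemma boundary_atom y (S : R -> Prop) v :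
    S 0 -> (forall a b, S a -> S b -> S (a - b)) ->
  (forall U, T U -> S (boundary y U)) -> S (boundary y (atom T v)).
Proof.
move=> S0 SB hS.
have SN a : S a -> S (- a) by move=> Sa; rewrite -sub0r; apply: SB.
rewrite -[atom T v]setCK boundaryC; apply: (SN).
have [Q [tQ <- sQ]] := atom_partition v ccT.
rewrite boundary_sum big_trivIset //=; elim/big_ind: _ => // [a b Sa Sb|X /sQ].
  by rewrite -[b]opprK; apply/SB/SN.
rewrite -boundary_sum; case/orP => [/eqP->|/andP[_ /orP[/hS//|/hS]]].
  by rewrite boundary0.
by rewrite boundaryC => /SN; rewrite opprK.
Qed.

Lemma boundary_saturated y X : (forall U, T U -> boundary y U = 0) ->
  saturated T X -> boundary y X = 0.
Proof.
move=> h0 satX; rewrite boundary_sum (partition_big (atom T) predT) //=.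
rewrite big1 // => K _.
have [v /andP[vX /eqP<-]|none] := pickP [pred v | (v \in X) && (atom T v == K)].
  rewrite (eq_bigl (mem (atom T v))) => [|w].
    rewrite -boundary_sum; apply: (boundary_atom (S := fun a => a = 0)) => //.
    by move=> a b -> ->; rewrite subrr.
  apply/andP/idP => [[_ /eqP<-]|wv]; first exact: atom_refl.
  by rewrite (satX _ _ wv) (eq_atom wv).
by rewrite big_pred0.
Qed.

End Boundary.

(** * Cuts of a digraph *)

Section Digraph.
Variables (V E : finType) (tl hd : E -> V).

Definition cutset (U : {set V}) : {set E} := [set e | (tl e \in U) != (hd e \in U)].
Definition enters (U : {set V}) : {set E} := [set e | (tl e \notin U) && (hd e \in U)].
Definition leaves (U : {set V}) : {set E} := [set e | (tl e \in U) && (hd e \notin U)].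

Lemma card_sum_mem (A : {set E}) : #|A| = (\sum_e (e \in A))%N.
Proof. by rewrite -sum1_card big_mkcond; apply: eq_bigr => e _; case: (e \in A). Qed.

Lemma card_cutset U : #|cutset U| = (#|enters U| + #|leaves U|)%N.
Proof.
rewrite !card_sum_mem -big_split; apply: eq_bigr => e _ /=; rewrite !inE.
by case: (tl e \in U); case: (hd e \in U).
Qed.

Lemma cutsetC U : cutset (~: U) = cutset U.
Proof. by apply/setP => e; rewrite !inE; case: (tl e \in U); case: (hd e \in U). Qed.

Lemma card_cutset_submod U W :
  (#|cutset (U :&: W)| + #|cutset (U :|: W)| <= #|cutset U| + #|cutset W|)%N.
Proof.
rewrite !card_sum_mem -!big_split; apply: leq_sum => e _ /=; rewrite !inE.
by case: (tl e \in U); case: (hd e \in U); case: (tl e \in W); case: (hd e \in W).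
Qed.

Lemma card_enters_submod U W :
  (#|enters (U :&: W)| + #|enters (U :|: W)| <= #|enters U| + #|enters W|)%N.
Proof.
rewrite !card_sum_mem -!big_split; apply: leq_sum => e _ /=; rewrite !inE.
by case: (tl e \in U); case: (hd e \in U); case: (tl e \in W); case: (hd e \in W).
Qed.

Lemma boundary_ind (C : {set E}) X :
  boundary tl hd (fun e => (e \in C)%:R) X
    = #|C :&: enters X|%:Z - #|C :&: leaves X|%:Z.
Proof.
rewrite -!natz !card_sum_mem !natr_sum -sumrB; apply: eq_bigr => e _; rewrite !inE.
by case: (e \in C); case: (tl e \in X); case: (hd e \in X).
Qed.

Lemma boundary_setT X :
  boundary tl hd (fun e => (e \in [set: E])%:R) X
    = #|enters X|%:Z *+ 2 - #|cutset X|%:Z.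
Proof. by rewrite boundary_ind !setTI card_cutset; lia. Qed.

End Digraph.

(** * Non-rainbow shores *)

Section Rainbow.
Variables (V E : finType) (tl hd : E -> V) (P : pred {set V}) (adj : rel E) (k : nat).

Local Notation cutset := (cutset tl hd).
Local Notation enters := (enters tl hd).
Local Notation leaves := (leaves tl hd).

Hypothesis ccP : crossing_closed P.
Hypothesis P_ge2 : forall U, P U -> (2 <= #|cutset U|)%N.
Hypothesis P_bal : forall U, P U -> #|cutset U| = 2 -> #|enters U| = 1%N.
Hypothesis adjP : forall e f,
  reflect (e != f /\ exists2 U, P U & cutset U = [set e; f]) (adj e f).
Hypothesis P_rainbow : forall U, P U ->
  {in cutset U &, forall e f, connect adj e f -> e = f} -> (k <= #|cutset U|)%N.

Let T : pred {set V} := fun U => P U && (#|cutset U| == 2).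
Let ind (C : {set E}) (e : E) : int := (e \in C)%:R.
Let bd (C : {set E}) := boundary tl hd (ind C).

Let adj_sym : symmetric adj.
Proof.
move=> e f; apply/adjP/adjP => -[ne [U PU eU]].
  by split; [rewrite eq_sym | exists U; rewrite // setUC].
by split; [rewrite eq_sym | exists U; rewrite // setUC].
Qed.

Let ccT : crossing_closed T.
Proof.
move=> U W /andP[PU /eqP dU] /andP[PW /eqP dW] ne nT.
have [PI PUn] := ccP PU PW ne nT.
have := card_cutset_submod tl hd U W; rewrite /T PI PUn dU dW.
by have := P_ge2 PI; have := P_ge2 PUn; lia.
Qed.

Let adj_closed (C : {set E}) := forall a b, adj a b -> (a \in C) = (b \in C).

(** The two cut edges of [W] are adjacent, so [C] contains both or neither; by balance one enters
    and the other leaves. *)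
Let bd_T C W : adj_closed C -> T W -> bd C W = 0.
Proof.
move=> clC /andP[PW /eqP dW].
have /cards2P[a [b [ab eW]]] : #|cutset W| == 2 by rewrite dW.
have Cab : (a \in C) = (b \in C) by apply: clC; apply/adjP; split=> //; exists W.
transitivity ((a \in C)%:R * bd [set: E] W); last first.
  by rewrite /bd boundary_setT dW (P_bal PW dW) subrr mulr0.
rewrite /bd /boundary mulr_sumr; apply: eq_bigr => e _; rewrite /ind !inE mul1r.
have [|] := boolP (e \in cutset W).
  by rewrite eW !inE => /orP[] /eqP ->; rewrite ?Cab.
by rewrite inE negbK => /eqP ->; rewrite subrr !mulr0.
Qed.

(** The net flow of all edges into a union of atoms vanishes. In particular its cut is even, which
    later excludes cuts with a single edge. *)
Let saturated_enters X : saturated T X -> (#|enters X| * 2)%N = #|cutset X|.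
Proof.
move=> satX; have clT : adj_closed [set: E] by move=> a b _; rewrite !inE.
have := boundary_saturated ccT (fun U => @bd_T [set: E] U clT) satX.
by rewrite boundary_setT; lia.
Qed.

(** A counterexample to [no_entering_edge_card] with the smallest cut. *)
Let minbad U := [/\ P U, #|enters U| = 0%N, (#|cutset U| < k)%N &
  forall U', P U' -> #|enters U'| = 0%N -> (#|cutset U| <= #|cutset U'|)%N].

(** By submodularity of [enters], one of [U :&: W] and [U :|: W] has no entering edge, so its cut is
    at least as large as that of [U]. Submodularity of cuts then leaves the other one with only two
    cut edges. *)
Let uncross_minbad U W : minbad U -> T W -> U :&: W != set0 -> U :|: W != setT ->
  minbad (U :&: W) /\ T (U :|: W) \/ T (U :&: W) /\ minbad (U :|: W).
Proof.
move=> [PU eU ltU minU] /andP[PW /eqP dW] ne nT.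
have [PI PUn] := ccP PU PW ne nT.
have eW := P_bal PW dW.
have hc := card_cutset_submod tl hd U W; have he := card_enters_submod tl hd U W.
have gI := P_ge2 PI; have gU := P_ge2 PUn.
have [eI|eI] := eqVneq #|enters (U :&: W)| 0%N.
  left; have mI := minU _ PI eI.
  split; last by rewrite /T PUn /=; lia.
  split=> //; first by lia.
  by move=> U' PU' eU'; have := minU _ PU' eU'; lia.
right; have eUn : #|enters (U :|: W)| = 0%N by lia.
have mU := minU _ PUn eUn.
split; first by rewrite /T PI /=; lia.
split=> //; first by lia.
by move=> U' PU' eU'; have := minU _ PU' eU'; lia.
Qed.

(** Of the two outcomes of uncrossing, the one whose two-edge shore separates [u] from [w] is
    impossible, as they share an atom. The net [C]-flow is unchanged because two-edge shores carry
    none. *)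
Let push_splitter C v u w U X : adj_closed C -> splitter T v X ->
    u \in atom T v -> w \in atom T v ->
    minbad U -> u \in U -> w \notin U ->
  exists U', [/\ minbad U', u \in U', w \notin U', bd C U' = bd C U &
    U' = U :|: X \/ U' = U :\: X].
Proof.
move=> clC sX uK wK mU uU wU.
have /subsetP sXK := splitter_sub_atomC sX.
have uX : u \notin X by apply/negP => /sXK; rewrite inE uK.
have wX : w \notin X by apply/negP => /sXK; rewrite inE wK.
have sep W : T W -> (u \in W) = (w \in W).
  by move=> TW; rewrite (atomP _ _ _ uK _ TW) (atomP _ _ _ wK _ TW).
have [dUX|] := eqVneq (U :&: X) set0.
  exists U; split=> //; right; apply/esym/setDidPl.
  by rewrite -setI_eq0 dUX.
move=> neUX; case/orP: (sX) => [/eqP X0|/andP[_ /orP[TX|TX]]].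
- by move: neUX; rewrite X0 setI0 eqxx.
- have nT : U :|: X != setT.
    by apply: contraNneq wU => e; have := in_setT w; rewrite -e inE (negPf wX) orbF.
  case: (uncross_minbad mU TX neUX nT) => -[h1 h2].
    by have := sep _ h2; rewrite !inE uU (negPf wU) (negPf wX).
  exists (U :|: X); split=> //; try by left.
  + by rewrite inE uU.
  + by rewrite inE negb_or wU.
  + have := boundaryUI tl hd (ind C) U X.
    by rewrite -!/(bd C _) (bd_T clC h1) (bd_T clC TX) !addr0.
- have [XU|XU] := boolP (X \subset U).
    by exists U; split=> //; left; apply/esym/setUidPl.
  have neU : U :&: ~: X != set0 by apply/set0Pn; exists u; rewrite !inE uU uX.
  have nT : U :|: ~: X != setT.
    apply: contraNneq XU => e; apply/subsetP => x xX.
    by have := in_setT x; rewrite -e !inE xX orbF.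
  case: (uncross_minbad mU TX neU nT) => -[h1 h2]; last first.
    by have := sep _ h1; rewrite !inE uU uX (negPf wU).
  rewrite -setDE in h1; exists (U :\: X); split=> //; try by right.
  + by rewrite inE uU uX.
  + by rewrite inE (negPf wU) andbF.
  + have := boundaryUI tl hd (ind C) U (~: X).
    by rewrite -!/(bd C _) (bd_T clC h2) (bd_T clC TX) add0r addr0 setDE.
Qed.

(** The blocks are disjoint, so pushing one does not undo what was achieved for another. *)
Let push_splitters C v u w U (Q : {set {set V}}) (L : seq {set V}) :
    adj_closed C -> trivIset Q -> {in Q, forall X, splitter T v X} ->
    {subset L <= Q} -> u \in atom T v -> w \in atom T v ->
    minbad U -> u \in U -> w \notin U ->
  exists U', [/\ minbad U', u \in U', w \notin U', bd C U' = bd C U &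
    {in L, forall X : {set V}, X \subset U' \/ [disjoint X & U']}].
Proof.
move=> clC /trivIsetP tQ sQ + uK wK mU uU wU.
elim: L => [|X L IHL] LQ; first by exists U; split.
have [|U1 [m1 u1 w1 b1 d1]] := IHL; first by move=> Y YL; apply: LQ; rewrite inE YL orbT.
have XQ : X \in Q by apply: LQ; rewrite inE eqxx.
have [U2 [m2 u2 w2 b2 e2]] := push_splitter clC (sQ _ XQ) uK wK m1 u1 w1.
exists U2; split=> //; first by rewrite b2.
have dX : X \subset U2 \/ [disjoint X & U2].
  case: e2 => ->; [by left; rewrite subsetUr | right].
  by rewrite -setI_eq0; apply/eqP/setP => x; rewrite !inE; case: (x \in X).
move=> Y; rewrite inE => /orP[/eqP-> //|YL].
have [->//|nYX] := eqVneq Y X.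
have YQ : Y \in Q by apply: LQ; rewrite inE YL orbT.
have dYX := tQ _ _ YQ XQ nYX.
case: (d1 _ YL) => dY; case: e2 => ->.
- by left; apply: subset_trans dY _; rewrite subsetUl.
- by left; rewrite subsetD dY.
- by right; rewrite -setI_eq0 setIUr setU_eq0 !setI_eq0 dY.
- right; apply: disjointWr dY; exact: subsetDl.
Qed.

Let blocks_saturated (Q : {set {set V}}) (Z : {set V}) :
    {in Q, forall X, saturated T X} -> Z \subset cover Q ->
    {in Q, forall X : {set V}, X \subset Z \/ [disjoint X & Z]} ->
  saturated T Z.
Proof.
move=> satQ /subsetP ZQ bQ.
have half v w : v \in atom T w -> v \in Z -> w \in Z.
  move=> vw vZ; have /bigcupP[X XQ vX] := ZQ _ vZ.
  case: (bQ _ XQ) => [/subsetP XZ|dX]; first by apply: XZ; rewrite -(satQ _ XQ _ _ vw).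
  by have := disjointFr dX vX; rewrite vZ.
move=> v w vw; apply/idP/idP; first exact: half.
by apply: half; rewrite (eq_atom vw) atom_refl.
Qed.

Let splitter_saturated v X : splitter T v X -> saturated T X.
Proof.
case/orP => [/eqP->|/andP[_ /orP[TX|TX]]]; first by move=> a b _; rewrite !inE.
  exact: saturated_mem.
by rewrite -[X]setCK; apply/saturatedC/saturated_mem.
Qed.

(* Start from the block of the partition containing [hd c] and keep adding the
   block at the other end of an edge leaving [Z] outside the atom: blocks have
   two cut edges, so [#|cutset Z| <= 2] is preserved. *)
Let block_at v c : tl c \in atom T v -> hd c \notin atom T v ->
  exists Z : {set V}, [/\ Z \subset ~: atom T v, saturated T Z, (#|enters Z| <= 1)%N,
    hd c \in Z & {in cutset Z, forall e, (tl e \in atom T v) || (hd e \in atom T v)}].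
Proof.
move=> tK hK; have [Q [tQ cQ sQ]] := atom_partition v ccT.
have card2 X x : X \in Q -> x \in X -> #|cutset X| = 2.
  move=> XQ xX; case/orP: (sQ _ XQ) => [/eqP X0|/andP[_]].
    by move: xX; rewrite X0 inE.
  by rewrite /T cutsetC => /orP[/andP[_ /eqP]|/andP[_ /eqP]].
have blk x : x \notin atom T v -> exists2 X, X \in Q & x \in X.
  by move=> xK; apply/bigcupP; rewrite -/(cover Q) cQ inE.
pose good (Z : {set V}) := [&& Z \subset ~: atom T v, hd c \in Z, #|cutset Z| <= 2 &
  [forall X in Q, (X \subset Z) || [disjoint X & Z]]]%N.
have [X0 X0Q hX0] := blk _ hK.
have good0 : good X0.
  apply/and4P; split=> //; first exact: splitter_sub_atomC (sQ _ X0Q).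
    by rewrite (card2 _ _ X0Q hX0).
  apply/forall_inP => X XQ; have [->|nX] := eqVneq X X0; first by rewrite subxx.
  by apply/orP; right; apply: (trivIsetP tQ).
case: (arg_maxnP (fun Z : {set V} => #|Z|) good0) => Z /and4P[ZK hZ dZ /forall_inP bZ] Zmax.
have satZ : saturated T Z.
  apply: (@blocks_saturated Q); rewrite ?cQ // => X XQ.
    exact: splitter_saturated (sQ _ XQ).
  by case/orP: (bZ _ XQ) => h; [left | right].
exists Z; split=> //.
  by have := saturated_enters satZ; lia.
move=> e; rewrite inE => eZ; apply/negPn/negP; rewrite negb_or => /andP[teK heK].
have [x [xZ xK ex]] : exists x, [/\ x \notin Z, x \notin atom T v & x = tl e \/ x = hd e].
  move: eZ; have [tZ|tZ] := boolP (tl e \in Z) => hZe.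
    by exists (hd e); split=> //; right.
  by exists (tl e); split=> //; left.
have [X XQ xX] := blk _ xK.
have dX : [disjoint X & Z].
  by case/orP: (bZ _ XQ) => // /subsetP /(_ _ xX); rewrite (negPf xZ).
have eX : e \in cutset X.
  rewrite inE; case: ex => ex; move: eZ; rewrite -ex (negPf xZ) xX.
    by case: (boolP (hd e \in X)) => // hX; rewrite (disjointFr dX hX).
  by case: (boolP (tl e \in X)) => // hX; rewrite (disjointFr dX hX).
(* [e] joins [Z] to the disjoint block [X]: it lies in both cuts but not in the cut of the union, so
   [Z :|: X] contradicts the maximality of [Z]. *)
suff /Zmax : good (Z :|: X).
  apply/negP; rewrite -ltnNge; apply/proper_card/properP; split; first exact: subsetUl.
  by exists x; rewrite // inE xX orbT.
apply/and4P; split.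
- by rewrite subUset ZK (splitter_sub_atomC (sQ _ XQ)).
- by rewrite inE hZ.
- have sub : cutset (Z :|: X) \subset (cutset Z :\ e) :|: (cutset X :\ e).
    apply/subsetP => f; rewrite !inE; have [->|_] /= := eqVneq f e; last first.
      by case: (tl f \in Z); case: (hd f \in Z); case: (tl f \in X); case: (hd f \in X).
    move: eX eZ; rewrite inE.
    have ft := disjointFr dX (x := tl e); have fh := disjointFr dX (x := hd e).
    case: (tl e \in X) ft => [/(_ isT)->|_]; case: (hd e \in X) fh => [/(_ isT)->|_] //=;
      by case: (_ \in Z).
  apply: leq_trans (subset_leq_card sub) _.
  apply: leq_trans (leq_card_setU _ _) _.
  move: dZ (card2 _ _ XQ xX).
  rewrite (cardsD1 e (cutset Z)) (cardsD1 e (cutset X)) eX inE eZ !add1n => le1 [->].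
  by rewrite addn1.
- apply/forall_inP => Y YQ; case/orP: (bZ _ YQ) => dY.
    by rewrite (subset_trans dY) ?subsetUl.
  have [->|nY] := eqVneq Y X; first by rewrite subsetUr.
  apply/orP; right; rewrite -setI_eq0 setIUr setU_eq0 !setI_eq0 dY /=.
  exact: (trivIsetP tQ).
Qed.

Let meets (Z : {set V}) e := (tl e \in Z) || (hd e \in Z).

(* If only one of the two cut edges of [W] met [Z], the saturated set [Z :&: W] or
   [Z :\: W] would have a single cut edge. *)
Let meets_closed v (Z : {set V}) a b : Z \subset ~: atom T v -> saturated T Z ->
    {in cutset Z, forall e, (tl e \in atom T v) || (hd e \in atom T v)} ->
  adj a b -> meets Z a -> meets Z b.
Proof.
move=> /subsetP ZK satZ cZ /adjP[ab [W PW eW]] mZa; apply/negPn/negP => mZb.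
have TW : T W by rewrite /T PW eW cards2 ab.
have [X [satX vX cX]] : exists X, [/\ saturated T X, v \notin X & cutset X = [set a; b]].
  have [vW|vW] := boolP (v \in W).
    exists (~: W); rewrite cutsetC inE vW; split=> //.
    exact/saturatedC/saturated_mem.
  by exists W; split=> //; apply: saturated_mem.
have KX x : x \in atom T v -> (x \notin X) && (x \notin Z).
  by move=> xK; rewrite (satX _ _ xK) vX; apply/negP => /ZK; rewrite inE xK.
have satY : saturated T (Z :&: X) by apply: saturatedI.
have := saturated_enters satY.
suff -> : cutset (Z :&: X) = [set a] by rewrite cards1; lia.
(* An edge in the cut of [Z] has an end in the atom, hence outside both [Z] and [X]; any other edge
   has both ends in [Z] or none. *)
have mem e : (e \in cutset (Z :&: X)) = (e \in cutset X) && meets Z e.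
  move: (atom T v) KX cZ => K KX cZ.
  move: (KX (tl e)) (KX (hd e)) (cZ e); rewrite /meets !inE.
  case: (tl e \in K) => [/(_ isT)/andP[/negPf-> /negPf->]|_];
    case: (hd e \in K) => [/(_ isT)/andP[/negPf-> /negPf->]|_];
    case: (tl e \in Z); case: (hd e \in Z) => //= h;
    rewrite ?orbF ?andbF ?andbT //; try by have := h isT.
apply/setP => e; rewrite mem cX !inE.
have [->|nea] /= := eqVneq e a; first by rewrite mZa.
by have [->|] := eqVneq e b; rewrite //= (negPf mZb).
Qed.

(* Let [U0] be a minimum counterexample and [C] a component with two edges in
   its cut.  Since [C] has zero net flow into unions of atoms, [U0] splits some
   atom [K]; pushing the blocks of the complement of [K] into or out of [U0]
   keeps its net [C]-flow, so two edges of [C] leave [K].  They enter the same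
   set [Z] of [block_at], which at most one edge enters. *)
Lemma no_entering_edge_card U : P U -> #|enters U| = 0%N -> (k <= #|cutset U|)%N.
Proof.
have gt1 (a b : nat) : a%:Z - b%:Z <= - 2 -> (1 < b)%N by lia.
move=> PU eU; rewrite leqNgt; apply/negP => ltU.
pose bad U := P U && (#|enters U| == 0%N).
have badU : bad U by rewrite /bad PU eU.
case: (arg_minnP (fun U => #|cutset U|) badU) => U0 /andP[PU0 /eqP eU0] U0min.
have mU0 : minbad U0.
  split=> //; first by apply: leq_ltn_trans ltU; apply: U0min.
  by move=> U' PU' eU'; apply: U0min; rewrite /bad PU' eU'.
have csym := sym_connect_sym adj_sym.
(* A cut with fewer than [k] edges is not rainbow. *)
have [e [f [eU1 fU1 cef nef]]] :
    exists e f, [/\ e \in cutset U0, f \in cutset U0, connect adj e f & e != f].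
  have : ~~ [forall e in cutset U0, forall f in cutset U0, connect adj e f ==> (e == f)].
    apply/negP => /forall_inP rb; case: mU0 => _ _ + _; rewrite ltnNge => /negP; apply.
    apply: P_rainbow => // e f eC fC cef.
    by move/forall_inP: (rb _ eC) => /(_ _ fC); rewrite cef => /eqP.
  case/forall_inPn => e eC /forall_inPn[f fC]; rewrite negb_imply => /andP[cef nef].
  by exists e, f.
pose C := [set x | connect adj e x].
have clC : adj_closed C.
  by move=> a b ab; rewrite !inE; apply: same_connect_r => //; apply: connect1.
have bU0 : bd C U0 <= - 2.
  have e0 : enters U0 = set0 by apply/eqP; rewrite -cards_eq0 eU0.
  rewrite /bd boundary_ind e0 setI0 cards0.
  suff : (1 < #|C :&: leaves U0|)%N by lia.
  apply/card_gt1P; exists e, f.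
  have lv x : x \in cutset U0 -> x \in leaves U0.
    move=> xU; have : x \notin enters U0 by rewrite e0 inE.
    by move: xU; rewrite !inE; case: (_ \in _); case: (_ \in _).
  by split=> //; rewrite in_setI lv // inE ?connect0 ?cef.
(* Otherwise [U0] would be a union of atoms and have zero net [C]-flow. *)
have [v [w [vw vU wU]]] : exists v w, [/\ w \in atom T v, v \in U0 & w \notin U0].
  have : ~~ [forall v in U0, forall w in atom T v, w \in U0].
    apply/negP => /forall_inP h.
    have satU : saturated T U0.
      move=> a b ab; have ba : b \in atom T a by rewrite (eq_atom ab) atom_refl.
      apply/idP/idP => [/h/forall_inP/(_ _ ba)//|/h/forall_inP/(_ _ ab)//].
    have b0 : bd C U0 = 0 := boundary_saturated ccT (fun U => @bd_T C U clC) satU.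
    by move: bU0; rewrite b0.
  by case/forall_inPn => v vU /forall_inPn[w vw wU]; exists v, w.
have [Q [tQ cQ sQ]] := atom_partition v ccT.
have [|U1 [m1 v1 w1 b1 d1]] :=
  push_splitters (L := enum Q) clC tQ sQ _ (atom_refl T v) vw mU0 vU wU.
  by move=> X; rewrite mem_enum.
(* After the pushes, the part of [U1] outside the atom is a union of blocks and has zero net
   [C]-flow; the deficit of two comes from the part inside. *)
have satD : saturated T (U1 :\: atom T v).
  apply: (@blocks_saturated Q).
  - by move=> X XQ; apply: splitter_saturated (sQ _ XQ).
  - by rewrite cQ setDE subsetIr.
  move=> X XQ; have XK := splitter_sub_atomC (sQ _ XQ).
  case: (d1 X); rewrite ?mem_enum // => dX; [left | right].
    by rewrite setDE subsetI dX.
  by apply: disjointWr dX; apply: subsetDl.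
have bK : bd C (U1 :&: atom T v) <= - 2.
  have b0 : bd C (U1 :\: atom T v) = 0 :=
    boundary_saturated ccT (fun U => @bd_T C U clC) satD.
  have : bd C U1 = bd C (U1 :&: atom T v) + bd C (U1 :\: atom T v).
    exact: boundaryD.
  by rewrite b0 addr0 => <-; rewrite b1.
have /card_gt1P[x [y []]] : (1 < #|C :&: leaves (U1 :&: atom T v)|)%N.
  by move: bK; rewrite /bd boundary_ind; apply: gt1.
rewrite !in_setI => /andP[xC xl] /andP[yC yl] nxy.
have cxy : connect adj x y.
  by apply: connect_trans (_ : connect adj x e) _; [rewrite csym|]; move: xC yC; rewrite !inE.
(* [a] is a cut edge of some two-edge shore, and such a shore does not separate two points of one
   atom. *)
have leaveK a b : a != b -> connect adj a b -> a \in leaves (U1 :&: atom T v) ->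
    (tl a \in atom T v) && (hd a \notin atom T v).
  move=> nab /connectP[[|c p] /= pth lst]; first by rewrite lst eqxx in nab.
  case/andP: pth => /adjP[nac [W PW eW]] _; rewrite inE => /andP[/setIP[_ tK] _].
  rewrite tK; apply/negP => hK.
  have TW : T W by rewrite /T PW eW cards2 nac.
  have : a \in cutset W by rewrite eW !inE eqxx.
  by rewrite inE (atomP _ _ _ tK _ TW) (atomP _ _ _ hK _ TW) eqxx.
have /andP[txK hxK] := leaveK _ _ nxy cxy xl.
have /andP[tyK hyK] : (tl y \in atom T v) && (hd y \notin atom T v).
  by apply: (leaveK y x); rewrite 1?eq_sym // csym.
have [Z [ZK satZ eZ xZ cZ]] := block_at txK hxK.
have yZ : meets Z y.
  have cl : closed adj [pred a | meets Z a].
    apply: (intro_closed csym) => a b ab; rewrite !inE.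
    exact: meets_closed ZK satZ cZ ab.
  by have := closed_connect cl cxy; rewrite !inE {1}/meets xZ orbT => <-.
move: eZ; rewrite leqNgt => /negP; apply; apply/card_gt1P; exists x, y.
have nK a : a \in atom T v -> a \notin Z.
  by move=> aK; apply/negP => /(subsetP ZK); rewrite inE aK.
by split=> //; rewrite inE nK //=; move: yZ; rewrite /meets (negPf (nK _ tyK)).
Qed.

End Rainbow.

(** * Integrality *)

Section Rounding.
Variables (R : realType) (V E : finType) (tl hd : E -> V) (P : pred {set V}).
Hypothesis ccP : crossing_closed P.

Local Notation enters := (enters tl hd).
Local Notation leaves := (leaves tl hd).
Local Notation boundary := (boundary tl hd).

(** [y e] is the fraction of [e] directed from [tl e] to [hd e]; the rest, [1 - y e], goes
    backwards. *)
Definition inflow (y : E -> R) (U : {set V}) : R :=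
  \sum_e ((e \in enters U)%:R * y e + (e \in leaves U)%:R * (1 - y e)).

(* The constraints [0 <= y e], [y e <= 1] and, for [P U], [1 <= inflow y U]. *)
Definition slack (y : E -> R) (i : E + E + {set V}) : R :=
  match i with
  | inl (inl e) => y e
  | inl (inr e) => 1 - y e
  | inr U => if P U then inflow y U - 1 else 0
  end.

Definition slack_diff (d : E -> R) (i : E + E + {set V}) : R :=
  match i with
  | inl (inl e) => d e
  | inl (inr e) => - d e
  | inr U => if P U then boundary d U else 0
  end.

Definition feasible y := forall i, 0 <= slack y i.

(** Inflow and boundary differ by an integer independent of [y], so tight sets have integral
    boundary. *)
Lemma inflow_boundary y U : inflow y U = boundary y U + #|leaves U|%:R.
Proof.
rewrite card_sum_mem natr_sum -big_split; apply: eq_bigr => e _ /=; rewrite !inE.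
by case: (tl e \in U); case: (hd e \in U) => /=; ring.
Qed.

Lemma slack_move y d (t : R) i :
  slack (fun e => y e + t * d e) i = slack y i + t * slack_diff d i.
Proof.
case: i => [[e|e]|U] /=; [by []|ring|].
case: (P U); last by rewrite mulr0 addr0.
rewrite !inflow_boundary.
have -> : boundary (fun e => y e + t * d e) U = boundary y U + t * boundary d U.
  by rewrite mulr_sumr -big_split; apply: eq_bigr => e _ /=; ring.
ring.
Qed.

Lemma inflow_submod y U W : (forall e, 0 <= y e <= 1) ->
  inflow y (U :&: W) + inflow y (U :|: W) <= inflow y U + inflow y W.
Proof.
move=> y01; rewrite -!big_split /=; apply: ler_sum => e _; rewrite !inE.
have /andP[y0 y1] := y01 e.
by case: (tl e \in U); case: (hd e \in U); case: (tl e \in W); case: (hd e \in W) => /=; lra.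
Qed.

Definition tight y : pred {set V} := fun U => P U && (inflow y U == 1).

Lemma feasible01 y e : feasible y -> 0 <= y e <= 1.
Proof.
move=> fy; have /= h0 := fy (inl (inl e)); have /= h1 := fy (inl (inr e)).
by rewrite h0 -subr_ge0.
Qed.

Lemma tight_crossing_closed y : feasible y -> crossing_closed (tight y).
Proof.
move=> fy U W /andP[PU /eqP yU] /andP[PW /eqP yW] ne nT.
have [PI PUn] := ccP PU PW ne nT.
have := inflow_submod U W (fun e => feasible01 e fy).
have := fy (inr (U :&: W)); have := fy (inr (U :|: W)); rewrite /= PI PUn yU yW => h1 h2 h3.
by split; rewrite /tight ?PI ?PUn /=; apply/eqP; lra.
Qed.

Lemma int01F (x : R) : 0 < x < 1 -> x \is a Num.int -> False.
Proof. by move=> x01 /intrP[m xm]; move: x01; rewrite xm ltr0z ltrz1; lia. Qed.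

Lemma class_sum (N : {set {set V}}) (u : {set V} -> R) k : k \in N ->
  \sum_(j < #|N|) (k == enum_val j)%:R * u (enum_val j) = u k.
Proof.
move=> kN; rewrite -(big_enum_val (fun j => (k == j)%:R * u j)) (bigD1 k) //= eqxx mul1r.
by rewrite big1 ?addr0 // => j /andP[_ /negPf]; rewrite eq_sym => ->; rewrite mul0r.
Qed.

(* Contract the atoms of the tight sets.  Each atom has integral boundary, so it
   is not incident with exactly one fractional edge; hence there are at most as
   many atoms as fractional edges, and the incidence matrix, whose rows sum to
   zero, has a nonzero left kernel. *)
Lemma tight_direction y e0 : feasible y -> 0 < y e0 < 1 ->
  exists d : E -> R, [/\ exists e, d e != 0, forall e, d e != 0 -> 0 < y e < 1
    & forall U, tight y U -> boundary d U = 0].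
Proof.
move=> fy ye0; have ccT := tight_crossing_closed fy.
pose F := [set e | 0 < y e < 1].
pose p e := atom (tight y) (tl e); pose q e := atom (tight y) (hd e).
have memU U v : tight y U -> (atom (tight y) v \subset U) = (v \in U).
  move=> tU; apply/idP/idP => [/subsetP|vU]; first by apply; apply: atom_refl.
  by apply/subsetP => w /atomP ->.
(* A fractional edge inside one atom is in no tight cut and can be varied on its own. *)
have [e /andP[eF /eqP pq]|noloop] := pickP [pred e | (e \in F) && (p e == q e)].
  exists (fun f => (f == e)%:R); split.
  - by exists e; rewrite eqxx oner_neq0.
  - by move=> f /=; have [-> _|_] := eqVneq f e; [move: eF; rewrite inE | rewrite eqxx].
  - move=> U tU; rewrite /boundary (bigD1 e) //= eqxx mul1r big1 ?addr0.
      by rewrite -(memU _ _ tU) -(memU U (tl e) tU) -/(p e) pq subrr.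
    by move=> f /negPf->; rewrite mul0r.
have e0F : e0 \in F by rewrite inE.
pose N := p @: F :|: q @: F.
have pN e : e \in F -> p e \in N by move=> eF; rewrite inE imset_f.
have qN e : e \in F -> q e \in N by move=> eF; rewrite inE imset_f ?orbT.
have deg2 k : k \in N -> (1 < #|[set e in F | (p e == k) || (q e == k)]|)%N.
  move=> kN.
  have [e eF ek] : exists2 e, e \in F & (p e == k) || (q e == k).
    by case/setUP: kN => /imsetP[e eF ->]; exists e; rewrite ?eqxx ?orbT.
  rewrite ltnNge; apply/negP => /card_le1_eqP le1.
  have ky : boundary y k \is a Num.int.
    have [v ->] : exists v, k = atom (tight y) v.
      by case/orP: ek => /eqP <-; [exists (tl e) | exists (hd e)].
    apply: (boundary_atom ccT (S := fun a => a \is a Num.int)) => [|a b|U].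
    - exact: rpred0.
    - exact: rpredB.
    - case/andP => _ /eqP yU; have := inflow_boundary y U; rewrite yU => /eqP.
      by rewrite -subr_eq => /eqP <-; rewrite rpredB ?rpred1 ?rpred_nat.
  have mk f : ((hd f \in k)%:R - (tl f \in k)%:R : R) = (q f == k)%:R - (p f == k)%:R.
    have h v : (v \in k) = (atom (tight y) v == k).
      have [w ->] : exists v, k = atom (tight y) v.
        by case/orP: ek => /eqP <-; [exists (tl e) | exists (hd e)].
      by apply/idP/eqP => [/eq_atom//|<-]; apply: atom_refl.
    by rewrite !h.
  (* All other edges at [k] have value 0 or 1, so the integral boundary of [k] would make [y e] an
     integer. *)
  have : y e * ((q e == k)%:R - (p e == k)%:R) \is a Num.int.
    rewrite -mk; move: ky; rewrite /boundary (bigD1 e) //=.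
    rewrite rpredDr //; apply: rpred_sum => f fe; rewrite mk.
    have [fF|fF] := boolP (f \in F).
      have [fk|] := boolP ((p f == k) || (q f == k)).
        by case/eqP: fe; apply: le1; rewrite !inE; rewrite !inE in eF fF; rewrite ?eF ?fF ?ek ?fk.
      by rewrite negb_or => /andP[/negPf-> /negPf->]; rewrite subrr mulr0 rpred0.
    rewrite rpredM ?rpredB ?rpred_nat //.
    have := feasible01 f fy; move: fF; rewrite inE negb_and -!leNgt.
    by case/orP => h1 /andP[h2 h3]; [have -> : y f = 0 by lra | have -> : y f = 1 by lra];
      rewrite ?rpred0 ?rpred1.
  have npq : p e != q e by have := noloop e; rewrite /= eF /= => ->.
  have ye : 0 < y e < 1 by move: eF; rewrite inE.
  case/orP: ek => /eqP ek.
    move: npq; rewrite ek eq_sym => /negPf ->; rewrite eqxx sub0r mulrN1 rpredN.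
    exact: int01F.
  by move: npq; rewrite ek => /negPf ->; rewrite eqxx subr0 mulr1; apply: int01F.
(* Double counting: an atom in [N] meets at least two fractional edges, an edge at most two
   atoms. *)
have leNF : (#|N| <= #|F|)%N.
  suff : (#|N| * 2 <= #|F| * 2)%N by lia.
  rewrite -!sum_nat_const; apply: leq_trans (_ : _ <=
    \sum_(k in N) #|[set e in F | (p e == k) || (q e == k)]|)%N _.
    by apply: leq_sum.
  under eq_bigr => k _ do rewrite -sum1dep_card big_mkcondr /=.
  rewrite exchange_big /=; apply: leq_sum => e eF.
  rewrite -big_mkcondr sum1dep_card.
  apply: leq_trans (_ : #|[set p e; q e]| <= _)%N; last by rewrite cards2; case: (_ != _).
  apply/subset_leq_card/subsetP => k; rewrite !inE => /andP[_].
  by rewrite ![_ == k]eq_sym.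
pose M := \matrix_(i < #|F|, j < #|N|)
  ((q (enum_val i) == enum_val j)%:R - (p (enum_val i) == enum_val j)%:R) : 'M[R]_(_, _).
have Mu (u : {set V} -> R) i :
    (M *m (\col_j u (enum_val j))) i 0 = u (q (enum_val i)) - u (p (enum_val i)).
  rewrite mxE; under eq_bigr => j _ do rewrite !mxE mulrBl.
  by rewrite sumrB !class_sum ?pN ?qN ?enum_valP.
(* With [#|N| <= #|F|], full row rank would force full column rank, but the all-ones vector is in
   the right kernel. *)
have nfree : ~~ row_free M.
  apply/negP => fr; have fullM : row_full M.
    rewrite /row_full eqn_leq rank_leq_col; move: fr; rewrite /row_free => /eqP ->.
    exact: leNF.
  have /row_fullP[B BM] := fullM.
  have M1 : M *m (\col_j (1 : R)) = 0.
    by apply/colP => i; rewrite (Mu (fun=> 1)) subrr mxE.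
  have : (\col_(j < #|N|) (1 : R)) = 0 by rewrite -[LHS]mul1mx -BM -mulmxA M1 mulmx0.
  have N0 : (0 < #|N|)%N by rewrite card_gt0; apply/set0Pn; exists (p e0); apply: pN.
  by move/colP/(_ (Ordinal N0)); rewrite !mxE => /eqP; rewrite oner_eq0.
have /rowV0Pn[v /sub_kermxP vM v0] : kermx M != 0 by rewrite kermx_eq0.
pose d e := if e \in F then v 0 (enum_rank_in e0F e) else 0.
have dv i : d (enum_val i) = v 0 i by rewrite /d enum_valP enum_valK_in.
exists d; split.
- have /rV0Pn[i vi] := v0; exists (enum_val i); by rewrite dv.
- by move=> e; rewrite /d; case: ifP; rewrite ?eqxx // inE.
- move=> U tU; pose u (k : {set V}) : R := (k \subset U)%:R.
  transitivity ((v *m (M *m (\col_j u (enum_val j)))) 0 0); last first.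
    by rewrite mulmxA vM mul0mx mxE.
  rewrite mxE; under eq_bigr => i _ do rewrite Mu -dv.
  rewrite -(big_enum_val (fun e => d e * (u (q e) - u (p e)))) /boundary.
  rewrite [LHS](bigID (mem F)) /= [X in _ + X]big1 ?addr0.
    by apply: eq_bigr => e _; rewrite /u /p /q !memU.
  by move=> e /negPf eF; rewrite /d eF mul0r.
Qed.

(** Ratio test: [t] is the least [a i / - b i] over the indices with [b i < 0]. *)
Lemma first_zero (I : finType) (a b : I -> R) :
    (forall i, 0 <= a i) -> (forall i, a i = 0 -> b i = 0) -> (exists i, b i < 0) ->
  exists t, [/\ 0 <= t, forall i, 0 <= a i + t * b i
    & exists2 i, a i != 0 & a i + t * b i = 0].
Proof.
move=> a0 ab [i0 bi0].
case: (arg_minP (P := fun i => b i < 0) (fun i => a i / - b i) bi0) => i bi imin.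
exists (a i / - b i); have nbi : 0 < - b i by rewrite oppr_gt0.
split.
- by rewrite divr_ge0 ?(ltW nbi).
- move=> j; have [bj|bj] := ltP (b j) 0.
    have := imin _ bj; have nbj : 0 < - b j by rewrite oppr_gt0.
    by rewrite ler_pdivlMr // mulrN => h; rewrite -subr_ge0 opprK in h; lra.
  by rewrite addr_ge0 // mulr_ge0 // divr_ge0 ?(ltW nbi).
- exists i; first by apply: contraTneq bi => /ab ->; rewrite ltxx.
  by field; apply: ltr0_neq0.
Qed.

(** Induction on the number of nonzero slacks: while a coordinate is fractional, moving along
    [tight_direction], with the sign that does not raise the cost, keeps zero slacks at zero and
    makes one more vanish. *)
Lemma feasible_rounding (c y : E -> R) : feasible y ->
  exists z, [/\ feasible z, forall e, z e = 0 \/ z e = 1,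
    forall U, tight y U -> tight z U & \sum_e c e * z e <= \sum_e c e * y e].
Proof.
pose m (y : E -> R) := #|[set i | slack y i != 0]|.
have [n] := ubnP (m y); elim: n y => // n IHn y lt_m fy.
have [e0 ye0|none] := pickP [pred e | 0 < y e < 1]; last first.
  exists y; split=> // e; have /andP[h0 h1] := feasible01 e fy.
  by have := none e; rewrite /= => /negbT; rewrite negb_and -!leNgt => /orP[]; lra.
have [d [[e1 de1] dF dT]] := tight_direction fy ye0.
wlog cd : d de1 dF dT / \sum_e c e * d e <= 0.
  move=> hw; have [|lt0] := lerP (\sum_e c e * d e) 0; first exact: hw.
  apply: (hw (fun e => - d e)).
  - by rewrite oppr_eq0.
  - by move=> e; rewrite oppr_eq0; apply: dF.
  - move=> U tU; have := dT _ tU; rewrite /boundary => h.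
    by under eq_bigr => e _ do rewrite mulNr; rewrite sumrN h oppr0.
  - by under eq_bigr => e _ do rewrite mulrN; rewrite sumrN oppr_le0 ltW.
have ab i : slack y i = 0 -> slack_diff d i = 0.
  case: i => [[e|e]|U] /=.
  - move=> y0; apply/eqP/negPn/negP => /dF; rewrite y0; lra.
  - move=> y1; apply/eqP; rewrite oppr_eq0; apply/negPn/negP => /dF; lra.
  - have [PU /eqP|//] := boolP (P U); rewrite subr_eq0 => tU.
    by apply: dT; rewrite /tight PU.
have [|t [t0 pos [i ai zi]]] := first_zero fy ab.
  have [de|de] := ltP (d e1) 0; first by exists (inl (inl e1)).
  by exists (inl (inr e1)); rewrite /= oppr_lt0 lt_neqAle eq_sym de1.
pose y1 e := y e + t * d e.
have fy1 : feasible y1 by move=> j; rewrite slack_move.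
have keep j : slack y j = 0 -> slack y1 j = 0.
  by move=> j0; rewrite slack_move j0 (ab _ j0) mulr0 addr0.
have lt1 : (m y1 < m y)%N.
  apply/proper_card/properP; split.
    by apply/subsetP => j; rewrite !inE; apply: contra => /eqP/keep ->.
  by exists i; rewrite inE // slack_move zi eqxx.
have [|z [fz z01 tz cz]] := IHn y1 _ fy1; first exact: leq_trans lt1 lt_m.
exists z; split=> //.
  move=> U /andP[PU /eqP yU]; apply: tz; rewrite /tight PU /=.
  by have := keep (inr U); rewrite /= PU yU subrr => /(_ erefl)/eqP; rewrite subr_eq0.
apply: le_trans cz _; rewrite /y1.
under eq_bigr => e _ do rewrite mulrDr mulrCA.
by rewrite big_split /= -mulr_sumr gerDl mulr_ge0_le0.
Qed.

End Rounding.

(** * Covering codes *)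

Section Covering.
Variable R : realType.

(** The logarithm of the right side is affine in [h], with slope [ln x - ln (1 - x) <= 0], and
    equals that of the left side at [h = x n]. For [x = 0] the hypothesis forces [h = 0]. *)
Lemma entropy_weight (x : R) (h n : nat) : 0 <= x <= 1 / 2 -> (h <= n)%N ->
    h%:R <= x * n%:R ->
  2 `^ (- (entropy x * n%:R)) <= x ^+ h * (1 - x) ^+ (n - h).
Proof.
move=> /andP[x0 x2] hn hx.
have [xz|nx] := eqVneq x 0.
  have -> : h = 0%N by apply/eqP; rewrite -leqn0 -(ler_nat R); move: hx; rewrite xz; lra.
  by rewrite /entropy xz eqxx mul0r oppr0 powRr0 addr0 expr1n expr0 mulr1.
have xp : 0 < x by rewrite lt_neqAle eq_sym nx.
have x1 : 0 < 1 - x by lra.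
have l2 : ln 2 != 0 :> R by rewrite gt_eqF // ln_gt0 // ltr1n.
have le_ln : ln x <= ln (1 - x) by rewrite ler_ln ?posrE //; lra.
have powE (z : R) (m : nat) : 0 < z -> z ^+ m = expR (m%:R * ln z).
  by move=> z0; rewrite expRM_natl lnK ?posrE.
rewrite /powR pnatr_eq0 /= !powE // -expRD ler_expR /entropy (negPf nx) /log2.
have -> : - ((- x * (ln x / ln 2) - (1 - x) * (ln (1 - x) / ln 2)) * n%:R) * ln 2
    = (x * ln x + (1 - x) * ln (1 - x)) * n%:R by field.
rewrite natrB // -subr_ge0.
have -> : h%:R * ln x + (n%:R - h%:R) * ln (1 - x)
    - (x * ln x + (1 - x) * ln (1 - x)) * n%:R
    = (x * n%:R - h%:R) * (ln (1 - x) - ln x) by ring.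
by rewrite mulr_ge0 ?subr_ge0.
Qed.

(* Averaging over the noise that flips each bit with probability [x] replaces
   the volume bound for Hamming balls. *)
Lemma covering_bound (I O : finType) (S : {set O}) (f : O -> I -> bool) (x : R) :
    0 <= x <= 1 / 2 ->
    (forall t : {ffun I -> bool},
       exists2 o, o \in S & #|[set i | f o i != t i]|%:R <= x * #|I|%:R) ->
  2 `^ ((1 - entropy x) * #|I|%:R) <= #|S|%:R.
Proof.
move=> x01 cov; have /andP[x0 x2] := x01.
(* [w t o] is the probability that the noise turns [f o] into [t]. The weights of each [o] sum to 1
   over all [t], so [#|S|] is the total weight. *)
pose w (t : {ffun I -> bool}) o := \prod_i (if f o i == t i then 1 - x else x).
have w1 o : \sum_t w t o = 1.
  rewrite /w -(bigA_distr_bigA (fun i b => if f o i == b then 1 - x else x)) big1 // => i _.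
  by rewrite big_bool; case: (f o i) => /=; ring.
have w0 t o : 0 <= w t o by apply: prodr_ge0 => i _; case: ifP => _ //; lra.
have wE (t : {ffun I -> bool}) o (h := #|[set i | f o i != t i]|) :
    w t o = x ^+ h * (1 - x) ^+ (#|I| - h).
  rewrite /w (bigID (fun i => f o i != t i)) /=.
  rewrite (eq_bigr (fun=> x)); last by move=> i /negPf ->.
  rewrite [X in _ * X](eq_bigr (fun=> 1 - x)); last by move=> i; rewrite negbK => ->.
  rewrite !prodr_const /h -(cardsC [set i | f o i != t i]) addKn cardsE.
  by congr (_ * _ ^+ _); apply: eq_card => i; rewrite !inE.
have -> : #|S|%:R = \sum_t \sum_(o in S) w t o :> R.
  rewrite exchange_big /= (eq_bigr (fun=> 1)) //.
  by rewrite sumr_const.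
have -> : (1 - entropy x) * #|I|%:R = #|I|%:R + - (entropy x * #|I|%:R) by ring.
rewrite powRD; last by rewrite pnatr_eq0 implybT.
set p := 2 `^ (- _).
have -> : 2 `^ #|I|%:R * p = \sum_(t : {ffun I -> bool}) p.
  by rewrite sumr_const card_ffun card_bool powR_mulrn // -natrX mulr_natl.
apply: ler_sum => t _.
have [o oS ho] := cov t; rewrite (bigD1 o oS) /=.
apply: le_trans (_ : w t o <= _); last by rewrite lerDl sumr_ge0.
by rewrite wE entropy_weight // max_card.
Qed.

End Covering.

(** * Strong orientations of a mixed graph *)

Section StrongOrientations.
Variables (R : realType) (G : mixedGraph).

Local Notation V := (vertices G).
Local Notation E := (edges G).
Local Notation adj := (@pseudo_dicut_graph2 G).

Definition shore : pred {set V} := fun U =>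
  [&& U != set0, U \proper [set: V] & [forall a : arcs G, ~~ arc_enters U a]].

Lemma shore_crossing_closed : crossing_closed shore.
Proof.
move=> U W /and3P[_ _ /forallP aU] /and3P[_ _ /forallP aW] ne nT.
have aIU a : ~~ arc_enters (U :&: W) a /\ ~~ arc_enters (U :|: W) a.
  have := aU a; have := aW a; rewrite /arc_enters !inE.
  by case: (_ \in U); case: (_ \in U); case: (_ \in W); case: (_ \in W).
split; apply/and3P; split=> //.
- rewrite properT; apply: contraNneq nT => e.
  by rewrite -subTset -e subIset // subsetUl.
- by apply/forallP => a; case: (aIU a).
- by apply: contraNneq ne => e; rewrite -subset0 -e subIset // subsetUl.
- by rewrite properT.
- by apply/forallP => a; case: (aIU a).
Qed.

Lemma pseudo_dicutP D : reflect (exists2 U, shore U & D = Defs.cut U) (pseudo_dicut D).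
Proof.
apply: (iffP existsP) => [[U /and4P[h1 h2 h3 /eqP ->]]|[U /and3P[h1 h2 h3] ->]].
  by exists U => //; apply/and3P.
by exists U; apply/and4P.
Qed.

Lemma cut_edgesE (o : orientation G) U :
  cut_edges (Defs.cut U) = cutset (edge_tail o) (edge_head o) U.
Proof.
apply/setP => e; rewrite !inE /edge_tail /edge_head.
by case: (o e); rewrite // eq_sym.
Qed.

Lemma graph2P (o : orientation G) e f :
  reflect (e != f /\ exists2 U, shore U
             & cutset (edge_tail o) (edge_head o) U = [set e; f]) (adj e f).
Proof.
apply: (iffP andP) => -[nef].
  case/existsP => D /andP[/pseudo_dicutP[U sU ->] /eqP eU]; split=> //.
  by exists U; rewrite // -cut_edgesE.
case=> U sU eU; split=> //; apply/existsP; exists (Defs.cut U).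
by rewrite (cut_edgesE o) eU eqxx andbT; apply/pseudo_dicutP; exists U.
Qed.

Local Notation ref_tail := (fun e : E => (ends e).1).
Local Notation ref_head := (fun e : E => (ends e).2).
Local Notation inflow := (@inflow R V E ref_tail ref_head).
Local Notation feasible := (@feasible R V E ref_tail ref_head shore).
Local Notation tight := (@tight R V E ref_tail ref_head shore).
Local Notation enters o := (enters (@edge_tail G o) (edge_head o)).
Local Notation leaves o := (leaves (@edge_tail G o) (edge_head o)).
Local Notation cutset o := (cutset (@edge_tail G o) (edge_head o)).

(** The expected direction of each edge when [o] is reversed on it with probability [x]. *)
Definition blur (x : R) (o : orientation G) (e : E) : R := if o e then 1 - x else x.

Lemma inflow_blur x o U :
  inflow (blur x o) U = (1 - x) * #|enters o U|%:R + x * #|leaves o U|%:R.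
Proof.
rewrite !card_sum_mem !natr_sum !mulr_sumr -big_split; apply: eq_bigr => e _ /=.
rewrite !inE /blur /edge_tail /edge_head.
by case: (o e); case: (_ \in U); case: (_ \in U) => /=; ring.
Qed.

Lemma feasible_blur x o : 0 <= x <= 1 ->
    (forall U, shore U -> 1 <= (1 - x) * #|enters o U|%:R + x * #|leaves o U|%:R) ->
  feasible (blur x o).
Proof.
move=> /andP[x0 x1] h [[e|e]|U] /=; rewrite ?/blur; try by case: (o e); lra.
by case: ifP => // /h; rewrite inflow_blur subr_ge0.
Qed.

(** If [v] is not reachable from [u], the set of all vertices not reachable from [u] is a shore that
    no edge enters. *)
Lemma strongP (o : orientation G) :
  (forall U, shore U -> enters o U != set0) -> strong o.
Proof.
move=> h; apply/forallP => u; apply/forallP => v; apply/negPn/negP => nuv.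
pose U := [set w | ~~ connect (oriented_adj o) u w].
have step a b : a \notin U -> b \in U -> ~~ oriented_adj o a b.
  rewrite !inE negbK => ua; apply: contra => ab.
  exact: connect_trans ua (connect1 ab).
have sU : shore U.
  apply/and3P; split; first by apply/set0Pn; exists v; rewrite inE.
    by rewrite properT; apply/eqP => /setP/(_ u); rewrite !inE connect0.
  apply/forallP => a; apply/negP => /andP[ta ha].
  have := step _ _ ta ha; rewrite /oriented_adj negb_or => /andP[/existsP[]]; exists a.
  by rewrite !eqxx.
have /set0Pn[e] := h _ sU; rewrite inE => /andP[te he].
have := step _ _ te he; rewrite /oriented_adj negb_or => /andP[_ /existsP[]]; exists e.
by rewrite !eqxx.
Qed.

Lemma orientation_rounding (c y : E -> R) : feasible y ->
  exists o : orientation G, [/\ strong o, forall U, tight y U -> #|enters o U| = 1%N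
    & \sum_e c e * (o e)%:R <= \sum_e c e * y e].
Proof.
move=> /(feasible_rounding shore_crossing_closed c)[z [fz z01 tz cz]].
pose o : orientation G := [ffun e => z e == 1].
have zo e : z e = (o e)%:R.
  by rewrite ffunE; case: (z01 e) => ->; rewrite ?eqxx // eq_sym oner_eq0.
have inz U : inflow z U = #|enters o U|%:R.
  have := inflow_blur 0 o U; rewrite subr0 mul1r mul0r addr0 => <-.
  by apply: eq_bigr => e _; rewrite zo /blur subr0; case: (o e).
exists o; split.
- apply: strongP => U sU; have := fz (inr U); rewrite /= sU inz subr_ge0 ler1n.
  by rewrite card_gt0.
- by move=> U /tz/andP[_]; rewrite inz pnatr_eq1 => /eqP.
- by under eq_bigr => e _ do rewrite -zo.
Qed.

Hypothesis hG : forall D : {set arcs G + edges G},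
  pseudo_dicut D -> (2 <= #|cut_edges D|)%N.

Lemma shore_ge2 o U : shore U -> (2 <= #|cutset o U|)%N.
Proof. by move=> sU; rewrite -cut_edgesE; apply/hG/pseudo_dicutP; exists U. Qed.

(** Cuts of shores have at least two edges, so the constant point [1 / 2] is feasible. Two-edge
    shores are tight there, and rounding keeps them tight. *)
Lemma balanced_orientation : exists o : orientation G,
  forall U, shore U -> #|cutset o U| = 2 -> #|enters o U| = 1%N.
Proof.
pose o0 : orientation G := [ffun=> true].
have half U : inflow (blur (1 / 2) o0) U = #|cutset o0 U|%:R / 2.
  by rewrite inflow_blur card_cutset natrD; field.
have [|o [_ to _]] := @orientation_rounding (fun=> 0) (blur (1 / 2) o0).
  apply: feasible_blur => [|U sU]; first by apply/andP; split; lra.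
  by rewrite -inflow_blur half; have := shore_ge2 o0 sU; rewrite -(ler_nat R); lra.
exists o => U sU; rewrite -cut_edgesE (cut_edgesE o0) => c2; apply: to.
by rewrite /tight sU half c2 /=; apply/eqP; lra.
Qed.

Lemma graph2_sym : symmetric adj.
Proof.
move=> e f; rewrite /pseudo_dicut_graph2 eq_sym; congr (_ && _).
by apply: eq_existsb => D; rewrite setUC.
Qed.

Variables (k : nat) (x : R).
Hypothesis x01 : 0 <= x <= 1 / 2.
Hypothesis rainbow_ge : forall D : {set arcs G + edges G},
  pseudo_dicut D -> rainbow D -> (k <= #|cut_edges D|)%N.
Hypothesis kx : forall n, (k <= n)%N -> (n <= #|E|)%N -> 1 <= x * n%:R.

(** A shore that no edge enters has at least [k] leaving edges. Otherwise, with [a] entering and [b]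
    leaving edges, the inflow exceeds 1 by [x (a + b - 2) + (1 - 2 x) (a - 1)], which is nonnegative
    for [x <= 1 / 2]. *)
Lemma balanced_feasible o :
    (forall U, shore U -> #|cutset o U| = 2 -> #|enters o U| = 1%N) ->
  feasible (blur x o).
Proof.
move=> bal; have /andP[x0 x2] := x01.
apply: feasible_blur => [|U sU]; first by apply/andP; split; lra.
have g2 := shore_ge2 o sU; have cE := card_cutset (edge_tail o) (edge_head o) U.
have [e0|e0] := eqVneq #|enters o U| 0%N.
  rewrite e0 mulr0 add0r; rewrite e0 add0n in cE; rewrite -cE; apply: kx; last exact: max_card.
  apply: (no_entering_edge_card (adj := adj) shore_crossing_closed (shore_ge2 o) bal) => //.
    exact: graph2P.
  move=> W sW rb; rewrite -cut_edgesE; apply: rainbow_ge; first by apply/pseudo_dicutP; exists W.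
  rewrite -cut_edgesE in rb.
  apply/forall_inP => e eW; apply/forall_inP => f fW; apply/implyP => cef.
  by apply/eqP; apply: rb.
have ge : 2 <= #|enters o U|%:R + #|leaves o U|%:R :> R by rewrite -natrD -cE ler_nat.
have e1 : 1 <= #|enters o U|%:R :> R by rewrite ler1n lt0n.
have l0 : 0 <= #|leaves o U|%:R :> R by rewrite ler0n.
have : 0 <= x * (#|enters o U|%:R + #|leaves o U|%:R - 2) by rewrite mulr_ge0 //; lra.
have : 0 <= (1 - 2 * x) * (#|enters o U|%:R - 1) by rewrite mulr_ge0 //; lra.
lra.
Qed.

Local Notation I := {e : E | roots adj e}.

Lemma strong_covering (t : {ffun I -> bool}) :
  exists2 o, o \in strong_orientations G
    & #|[set i | o (val i) != t i]|%:R <= x * #|{: I}|%:R.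
Proof.
have csym := sym_connect_sym graph2_sym.
have [o1 bal1] := balanced_orientation.
pose rt e : I := Sub (fingraph.root adj e) (roots_root csym e).
(* Flip whole components of [o1] so that their roots read [t]. The two cut edges of a two-edge shore
   are flipped together, so it stays balanced. *)
pose s : orientation G := [ffun e => o1 e (+) (o1 (val (rt e)) (+) t (rt e))].
have rt_val (i : I) : rt (val i) = i by apply/val_inj/eqP; exact: (valP i).
have sI (i : I) : s (val i) = t i by rewrite ffunE rt_val addKb.
have bal U : shore U -> #|cutset s U| = 2 -> #|enters s U| = 1%N.
  move=> sU; rewrite -cut_edgesE (cut_edgesE o1) => c2.
  have /cards2P[a [b [ab eU]]] : #|cutset o1 U| == 2 by rewrite c2.
  have rab : rt a = rt b.
    apply/val_inj/eqP; rewrite /= root_connect //; apply: connect1.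
    by apply/(graph2P o1); split=> //; exists U.
  have e1 := bal1 _ sU c2; have := card_cutset (edge_tail o1) (edge_head o1) U.
  rewrite c2 e1 => -[l1].
  pose b0 := o1 (val (rt a)) (+) t (rt a).
  have sE e : e \in cutset o1 U -> s e = o1 e (+) b0.
    by rewrite eU ffunE !inE => /orP[] /eqP ->; rewrite /b0 ?rab.
  have <- : #|if b0 then leaves o1 U else enters o1 U| = 1%N by case: b0 {sE}.
  case: (b0) sE => sE; apply: eq_card => e; have := sE e;
    rewrite !inE /edge_tail /edge_head; case: (s e); case: (o1 e);
    by case: (_ \in U); case: (_ \in U) => //= h; have := h isT.
(* Up to the constant [\sum_i t i], this cost counts the roots at which a 0/1 point disagrees with
   [t]; at the blurred [s] it amounts to [x] per root. *)
pose g (i : I) : R := if t i then -1 else 1.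
pose c e : R := \sum_(i : I) (val i == e)%:R * g i.
have cE (z : E -> R) : \sum_e c e * z e = \sum_(i : I) g i * z (val i).
  under eq_bigr => e _ do rewrite mulr_suml.
  rewrite exchange_big /=; apply: eq_bigr => i _.
  rewrite (bigD1 (val i)) //= eqxx mul1r big1 ?addr0 // => e.
  by rewrite eq_sym => /negPf ->; rewrite !mul0r.
have [o [so _]] := orientation_rounding c (balanced_feasible bal).
rewrite !cE => le; exists o; first by rewrite inE.
rewrite card_sum_mem natr_sum.
have -> : x * #|{: I}|%:R = \sum_(i : I) (g i * blur x s (val i) + (t i)%:R).
  rewrite -sum1_card natr_sum mulr_sumr; apply: eq_bigr => i _.
  by rewrite /blur sI /g; case: (t i) => /=; ring.
rewrite big_split /= -lerBlDr; apply: le_trans le; rewrite -sumrB.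
apply: ler_sum => i _; rewrite inE /g.
by case: (o (val i)); case: (t i) => /=; lra.
Qed.

Lemma strong_orientations_ge :
  2 `^ ((1 - entropy x) * (num_components2 G)%:R) <= #|strong_orientations G|%:R.
Proof.
have -> : num_components2 G = #|{: I}|.
  rewrite card_sig /num_components2 /n_comp_mem; apply: eq_card => e.
  by rewrite !inE andbT.
exact: (@covering_bound R _ (orientation G) _ (fun o i => o (val i)) _ x01 strong_covering).
Qed.

End StrongOrientations.

(** * The smallest rainbow pseudo dicut and the entropy bound *)

Lemma rainbow_minP (R : realType) (G : mixedGraph) :
  (rainbow_min G R = +oo%E /\ forall D, @pseudo_dicut G D -> rainbow D -> False)
  \/ (exists2 D0, @pseudo_dicut G D0 & rainbow_min G R = #|cut_edges D0|%:R%:E /\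
      forall D, @pseudo_dicut G D -> rainbow D -> (#|cut_edges D0| <= #|cut_edges D|)%N).
Proof.
pose rb D := @pseudo_dicut G D && rainbow D.
have [D1 rD1|none] := pickP rb; last first.
  left; split; first by rewrite /rainbow_min big_pred0.
  by move=> D pD rD; have := none D; rewrite /rb pD rD.
right; case: (arg_minnP (P := rb) (fun D => #|cut_edges D|) rD1) => D0 rD0 D0min.
exists D0; first by case/andP: rD0.
split; last by move=> D pD rD; apply: D0min; rewrite /rb pD.
apply/le_anti/andP; split; first exact: bigmin_le_cond rD0.
apply: le_bigmin; first exact: leey.
by move=> D /D0min; rewrite lee_fin ler_nat.
Qed.

Theorem theorem6p2 (R : realType) (G : mixedGraph)
    (hG : forall D : {set arcs G + edges G},
        pseudo_dicut D -> (2 <= #|cut_edges D|)%N) :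
  2 `^ ((1 - entropy_inv (rainbow_min G R)) * (num_components2 G)%:R)
    <= #|strong_orientations G|%:R :> R.
Proof.
case: (rainbow_minP R G) => [[-> none]|[D0 pD0 [-> D0min]]] /=.
  have -> : 0 = entropy 0 :> R by rewrite /entropy eqxx.
  (* An infinite minimum corresponds to [x = 0]; with [k] above the number of edges, no [n] has to
     satisfy [1 <= x * n]. *)
  apply: (strong_orientations_ge hG (k := #|edges G|.+1)).
  - by apply/andP; split; lra.
  - by move=> D pD rD; case: (none D pD rD).
  - by move=> n lt le; move: (leq_trans lt le); rewrite ltnn.
(* This places [1 / kappa] in the range [[0, 1 / 2]] required of [x]. *)
have k2 : 2 <= #|cut_edges D0|%:R :> R by rewrite ler_nat; apply: hG.
apply: (strong_orientations_ge hG _ D0min).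
  apply/andP; split; first by rewrite divr_ge0 //; lra.
  by rewrite ler_pdivrMr; lra.
by move=> n le _; rewrite mulrAC ler_pdivlMr ?mul1r ?ler_nat //; lra.
Qed.
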